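(* Let $\alpha$ be a monotone balanced non-projection connective, let $n$ be even, and let the support of $\mu$ comprise exactly the $n$ projection functions and the two constants. Then the limiting distribution of the growth process $(\mu,\alpha)$ is uniform on the slice functions in $\mathcal S_{n/2,n}$.
   Context: A connective is a $k$-adic Boolean function $\alpha:\{0,1\}^k\to\{0,1\}$; it is balanced if it takes the value 1 on exactly half of its inputs. The initial distribution $\mu$ is uniform on its support, here $\{x_1,\dots,x_n,0,1\}$. The growth process $(\mu,\alpha)$ gives distributions $\pi_i$ on $n$-adic Boolean functions: $\pi_0=\mu$, and for $i\ge1$, $\pi_i(f)$ is the probability that $\alpha(g_1,\dots,g_k)=f$ where $g_1,\dots,g_k$ are independent random functions distributed according to $\pi_{i-1}$. The limiting distribution is $\pi=\lim_{i\to\infty}\pi_i$ (pointwise). The family $\mathcal S_{m,n}$ of slice functions consists of the $n$-adic Boolean functions that take the value 1 on all assignments of weight greater than $m$, the value 0 on all assignments of weight less than $m$, and either value on assignments of weight exactly $m$ (weight = number of ones). *)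

(* Defs.v *)
From mathcomp Require Import all_boot all_order all_algebra.
From mathcomp Require Import all_classical all_reals all_analysis.

Set Implicit Arguments.
Unset Strict Implicit.
Unset Printing Implicit Defensive.

Import Order.TTheory GRing.Theory Num.Theory.
Import numFieldNormedType.Exports.

Local Open Scope classical_set_scope.
Local Open Scope ring_scope.

Definition assignment (n : nat) := {ffun 'I_n -> bool}.

Definition bool_fun (n : nat) := {ffun assignment n -> bool}.

Definition weight (n : nat) (x : assignment n) : nat := #|[set i | x i]%SET|.

Definition proj_fun (n : nat) (i : 'I_n) : bool_fun n :=
  [ffun x : assignment n => x i].

Definition const_fun (n : nat) (b : bool) : bool_fun n := [ffun=> b].

Definition monotone_fun (k : nat) (alpha : bool_fun k) : Prop :=
  forall x y : assignment k, (forall j, x j ==> y j) -> alpha x ==> alpha y.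

Definition balanced (k : nat) (alpha : bool_fun k) : Prop :=
  (2 * #|[set x | alpha x]%SET| = #|{: assignment k}|)%N.

Definition is_projection (k : nat) (alpha : bool_fun k) : Prop :=
  exists j : 'I_k, alpha = proj_fun j.

Definition compose (k n : nat) (alpha : bool_fun k)
    (g : {ffun 'I_k -> bool_fun n}) : bool_fun n :=
  [ffun x => alpha [ffun j => g j x]].

Definition uniform_on (R : realType) (T : finType) (A : {set T}) (x : T) : R :=
  if x \in A then #|A|%:R^-1 else 0.

Definition initial_support (n : nat) : {set bool_fun n} :=
  ([set proj_fun i | i : 'I_n] :|: [set const_fun n false; const_fun n true])%SET.

(* The law of [compose alpha g] when g_0, ..., g_(k-1) are independent with
   common law p: the tuple g has probability \prod_j p (g j). *)
Definition growth_step (R : realType) (k n : nat) (alpha : bool_fun k)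
    (p : bool_fun n -> R) (f : bool_fun n) : R :=
  \sum_(g : {ffun 'I_k -> bool_fun n} | compose alpha g == f)
    \prod_(j < k) p (g j).

Definition growth (R : realType) (k n : nat) (mu : bool_fun n -> R)
    (alpha : bool_fun k) (i : nat) : bool_fun n -> R :=
  iter i (growth_step alpha) mu.

(* Asserts both that the pointwise limit exists and that it is p. *)
Definition limiting_distribution (R : realType) (k n : nat)
    (mu : bool_fun n -> R) (alpha : bool_fun k) (p : bool_fun n -> R) : Prop :=
  forall f : bool_fun n, growth mu alpha i f @[i --> \oo] --> p f.

Definition slice_functions (m n : nat) : {set bool_fun n} :=
  [set f : bool_fun n | [forall x : assignment n,
     ((m < weight x)%N ==> f x) && ((weight x < m)%N ==> ~~ f x)]]%SET.

(* Main.v *)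
Require Import Defs.
From mathcomp Require Import all_boot all_order all_algebra.
From mathcomp Require Import all_classical all_reals all_analysis.
From mathcomp Require Import ring lra.

(** Write A(p) for the probability that alpha outputs 1 on independent
    p-biased bits.  At a point x, the probability that the random function is 1
    evolves by p -> A(p).  For monotone alpha the odds ratio of A between p < q
    is at least that of p and q, strictly unless alpha is constant or a
    projection (induction on the arity).  As A(1/2) = 1/2, this yields A(q) > q
    for 1/2 < q < 1 and A(p) < p for 0 < p < 1/2.  Initially p is
    (weight x + 1) / (n + 2), so above and below the middle layer p tends to 1
    and 0, and on the middle layer it stays at 1/2.

    For a set T of points of the middle layer, the moment
    E[prod_(x in T) (-1)^f(x)] at the next step is, by expanding alpha in its
    Fourier basis, [sum_U c_U^|T| * moment(T)^|U|] plus a combination of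
    products each containing the moment of a proper nonempty subset of T.
    Since sum_U c_U^2 = 1, c_set0 = 0 and no |c_U| is 1, all moments with T
    nonempty tend to 0: for |T| = 1 they vanish, for |T| = 2 the recurrence is
    exact and contracting because some c_U with |U| >= 2 is nonzero and the
    initial moment has absolute value < 1, and for |T| >= 3 one inducts with
    contraction rate sum_U |c_U|^|T| < 1.  Hence the restriction to the middle
    layer becomes uniform. *)

Set Implicit Arguments.
Unset Strict Implicit.
Unset Printing Implicit Defensive.

Import Order.TTheory GRing.Theory Num.Theory.
Import numFieldNormedType.Exports.

Local Open Scope classical_set_scope.
Local Open Scope ring_scope.

(** * Preliminaries on finite functions *)

Lemma ffun_neq (I : finType) (T : eqType) (f g : {ffun I -> T}) :
  f != g -> exists x, f x != g x.
Proof.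
move=> /eqP fg.
case: (boolP [exists x, f x != g x]) => [/existsP //|/existsPn H]; case: fg.
by apply/ffunP => x; have := H x; rewrite negbK => /eqP.
Qed.

Lemma sum_bool_fun k (a : bool_fun k) :
  (\sum_(x : assignment k) a x)%N = #|[set x | a x]%SET|.
Proof.
rewrite -sum1dep_card [RHS]big_mkcond; apply: eq_bigr => x _.
by case: (a x).
Qed.

Lemma bool_fun0 (a : bool_fun 0) : a = const_fun 0 (a [ffun=> true]).
Proof. by apply/ffunP => x; rewrite ffunE; congr (a _); apply/ffunP; case. Qed.

(** * The odds ratio inequality *)

Definition acons (k : nat) (b : bool) (x : assignment k) : assignment k.+1 :=
  [ffun j => if unlift ord0 j is Some i then x i else b].

Definition cofactor_fun (k : nat) (a : bool_fun k.+1) (b : bool) : bool_fun k :=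
  [ffun x => a (acons b x)].

Lemma acons0 k b (x : assignment k) : acons b x ord0 = b.
Proof. by rewrite ffunE unlift_none. Qed.

Lemma acons_lift k b (x : assignment k) i : acons b x (lift ord0 i) = x i.
Proof. by rewrite ffunE liftK. Qed.

Lemma acons_eta k (x : assignment k.+1) :
  acons (x ord0) [ffun i => x (lift ord0 i)] = x.
Proof.
apply/ffunP => j; rewrite ffunE.
by case: unliftP => [i|] ->; rewrite ?ffunE.
Qed.

Lemma sum_acons (V : nmodType) k (F : assignment k.+1 -> V) :
  \sum_(x : assignment k.+1) F x =
  \sum_(b : bool) \sum_(x : assignment k) F (acons b x).
Proof.
rewrite pair_bigA (reindex (fun u : bool * assignment k => acons u.1 u.2)) //=.
exists (fun x : assignment k.+1 => (x ord0, [ffun i => x (lift ord0 i)])).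
  move=> [b x] _ /=; rewrite acons0; congr pair.
  by apply/ffunP => i; rewrite ffunE acons_lift.
by move=> x _; rewrite /= acons_eta.
Qed.

Section Amplification.
Variable R : realFieldType.
Implicit Types p q : R.

Definition bernoulli_weight p (b : bool) : R := if b then p else 1 - p.

Definition amplification (k : nat) (a : bool_fun k) p : R :=
  \sum_(x : assignment k) (a x)%:R * \prod_(j < k) bernoulli_weight p (x j).

Local Notation amp := amplification.

Lemma bernoulli_weight_ge0 p b : 0 <= p <= 1 -> 0 <= bernoulli_weight p b.
Proof. by case: b => /andP[? ?] //=; rewrite subr_ge0. Qed.

Lemma amplification_const k b p : amp (const_fun k b) p = b%:R.
Proof.
rewrite /amp; under eq_bigr do rewrite ffunE.
rewrite -mulr_sumr -(bigA_distr_bigA (fun=> bernoulli_weight p)) big1 ?mulr1 //.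
by move=> i _; rewrite big_bool /= addrC subrK.
Qed.

Lemma amplification_rec k (a : bool_fun k.+1) p :
  amp a p = p * amp (cofactor_fun a true) p
            + (1 - p) * amp (cofactor_fun a false) p.
Proof.
rewrite /amp sum_acons big_bool /=.
congr (_ + _); rewrite mulr_sumr; apply: eq_bigr => x _;
  rewrite big_ord_recl acons0 ffunE mulrCA; congr (_ * (_ * _));
  by apply: eq_bigr => i _; rewrite acons_lift.
Qed.

Lemma le_amplification k (a b : bool_fun k) p : 0 <= p <= 1 ->
  (forall x, a x ==> b x) -> amp a p <= amp b p.
Proof.
move=> p01 ab; apply: ler_sum => x _; apply: ler_wpM2r.
  by apply: prodr_ge0 => j _; exact: bernoulli_weight_ge0.
by move: (ab x); case: (a x); case: (b x).
Qed.

Lemma lt_amplification k (a b : bool_fun k) p : 0 < p < 1 ->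
  (forall x, a x ==> b x) -> a != b -> amp a p < amp b p.
Proof.
move=> p01 ab /ffun_neq[x axb].
have p01' : 0 <= p <= 1 by case/andP: p01 => p0 p1; rewrite !ltW.
rewrite /amp (bigD1 x) //= [ltRHS](bigD1 x) //=; apply: ltr_leD.
  have -> : b x = true by move: (ab x) axb; case: (a x); case: (b x).
  have -> : a x = false by move: (ab x) axb; case: (a x); case: (b x).
  rewrite mul0r mul1r; apply: prodr_gt0 => j _.
  by rewrite /bernoulli_weight; case: (x j); case/andP: p01 => p0 p1 //; rewrite subr_gt0.
apply: ler_sum => y _; apply: ler_wpM2r.
  by apply: prodr_ge0 => j _; exact: bernoulli_weight_ge0.
by move: (ab y); case: (a y); case: (b y).
Qed.

Lemma amplification_ge0_le1 k (a : bool_fun k) p : 0 <= p <= 1 ->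
  0 <= amp a p <= 1.
Proof.
move=> p01; apply/andP; split.
  rewrite -[leLHS](amplification_const k false p); apply: le_amplification => // x.
  by rewrite ffunE.
rewrite -[leRHS](amplification_const k true p); apply: le_amplification => // x.
by rewrite [const_fun _ _ _]ffunE implybT.
Qed.

Lemma monotone_cofactor k (a : bool_fun k.+1) b :
  monotone_fun a -> monotone_fun (cofactor_fun a b).
Proof.
move=> am x y xy; rewrite !ffunE; apply: am => j; rewrite !ffunE.
by case: unlift => [i|] //; case: b.
Qed.

Lemma monotone_cofactor_le k (a : bool_fun k.+1) x :
  monotone_fun a -> cofactor_fun a false x ==> cofactor_fun a true x.
Proof.
move=> am; rewrite !ffunE; apply: am => j; rewrite !ffunE.
by case: unlift => [i|] /=; rewrite ?implybb.
Qed.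

Lemma cofactor_eq k (a b : bool_fun k.+1) :
  (forall c, cofactor_fun a c = cofactor_fun b c) -> a = b.
Proof.
move=> E; apply/ffunP => x; rewrite -(acons_eta x).
by have /ffunP/(_ [ffun i => x (lift ord0 i)]) := E (x ord0); rewrite !ffunE.
Qed.

(** With [D0 = v * (1 - a0) + u * a0] and [D1] likewise, the hypotheses of [cross_odds_ge0] are
    equalities at [a0' = u * a0 / D0] and [a1' = u * a1 / D1]. The multiplier clears these
    denominators; the first two summands carry the slack in the hypotheses, the last is the value at
    equality. *)
Lemma cross_odds_expand (u v a0 a1 a0' a1' : R) :
  (v * (1 - a0) + u * a0) * (v * (1 - a1) + u * a1) *
  (u * v * a1' * (1 - a0) + v ^+ 2 * a0' * (1 - a1)
   - u * v * a1 * (1 - a0') - u ^+ 2 * a0 * (1 - a1')) =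
  (v * (1 - a0) + u * a0) * (u * v * (1 - a0) + u ^+ 2 * a0)
    * (v * a1' * (1 - a1) - u * a1 * (1 - a1'))
  + (v * (1 - a1) + u * a1) * (v ^+ 2 * (1 - a1) + u * v * a1)
    * (v * a0' * (1 - a0) - u * a0 * (1 - a0'))
  + u * v * (a1 - a0) * (u * (v * (1 - a0) + u * a0) - v * (v * (1 - a1) + u * a1)).
Proof. ring. Qed.

(** The last summand is nonnegative since [u * D0 >= u * v >= v * D1], both denominators being
    weighted means of [u] and [v]. The first inequality is strict if [0 < a0], the second if
    [a1 < 1]. *)
Lemma cross_odds_ge0 (u v a0 a1 a0' a1' : R) :
  0 < v < u -> 0 <= a0 -> a0 <= a1 -> a1 <= 1 ->
  u * a1 * (1 - a1') <= v * a1' * (1 - a1) ->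
  u * a0 * (1 - a0') <= v * a0' * (1 - a0) ->
  let e := u * v * a1' * (1 - a0) + v ^+ 2 * a0' * (1 - a1)
           - u * v * a1 * (1 - a0') - u ^+ 2 * a0 * (1 - a1') in
  0 <= e /\ (a0 < a1 -> (0 < a0) || (a1 < 1) -> 0 < e).
Proof.
move=> /andP[v0 uv] a00 a01 a11 h1 h0 e.
have u0 : 0 < u by exact: lt_trans uv.
have D0v : v <= v * (1 - a0) + u * a0 by nra.
have D1u : v * (1 - a1) + u * a1 <= u by nra.
have D0 : 0 < v * (1 - a0) + u * a0 by exact: lt_le_trans D0v.
have D1 : 0 < v * (1 - a1) + u * a1 by nra.
have DD := mulr_gt0 D0 D1.
have := cross_odds_expand u v a0 a1 a0' a1'.
rewrite -/e; set T1 := (X in _ = X + _ + _); set T2 := (X in _ = _ + X + _).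
set T3 := (X in _ = _ + X) => E.
have T1_ge0 : 0 <= T1.
  apply: mulr_ge0; last by lra.
  apply: mulr_ge0; first exact: ltW.
  by apply: addr_ge0; rewrite !mulr_ge0 ?exprn_ge0 //; lra.
have T2_ge0 : 0 <= T2.
  apply: mulr_ge0; last by lra.
  apply: mulr_ge0; first exact: ltW.
  by apply: addr_ge0; rewrite !mulr_ge0 ?exprn_ge0 //; lra.
have T3_ge0 : 0 <= T3.
  apply: mulr_ge0; last by nra.
  by rewrite !mulr_ge0 ?subr_ge0 // ltW.
split=> [|lt01 ne].
  by rewrite -(pmulr_rge0 _ DD) E !addr_ge0.
rewrite -(pmulr_rgt0 _ DD) E ltr_wpDl ?addr_ge0 //.
rewrite /T3 mulr_gt0 ?mulr_gt0 ?subr_gt0 //.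
case/orP: ne => ?.
  have : v < v * (1 - a0) + u * a0 by nra.
  by nra.
have : v * (1 - a1) + u * a1 < u by nra.
by nra.
Qed.

Definition is_constant (k : nat) (a : bool_fun k) : Prop :=
  exists b, a = const_fun k b.

(** The odds ratios are cross-multiplied, so amplifications 0 and 1 need no separate treatment.
    After splitting on the first input, equal cofactors reduce strictness to the induction
    hypothesis. Distinct ones make the cross term positive, unless they are the constants 0 and 1,
    and then [a] is the first projection. *)
Lemma amplification_odds k (a : bool_fun k) p q :
  monotone_fun a -> 0 < p -> p < q -> q < 1 ->
  let d := p * (1 - q) * amp a q * (1 - amp a p)
           - q * (1 - p) * amp a p * (1 - amp a q) in
  0 <= d /\ (~ is_constant a -> ~ is_projection a -> 0 < d).
Proof.
move=> am p0 pq q1; elim: k a am => [|k IH] a am.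
  rewrite (bool_fun0 a) !amplification_const; split; first by case: (a _) => /=; lra.
  by move=> /(_ (ex_intro _ _ erefl)).
set v := p * (1 - q); set u := q * (1 - p).
have uv : 0 < v < u.
  by apply/andP; split; rewrite /u /v; [apply: mulr_gt0; lra | lra].
have p01 : 0 < p < 1 by apply/andP; split => //; lra.
have q01 : 0 < q < 1 by apply/andP; split => //; lra.
have p01w : 0 <= p <= 1 by apply/andP; split; lra.
have [d1 s1] := IH _ (monotone_cofactor true am).
have [d0 s0] := IH _ (monotone_cofactor false am).
rewrite !(amplification_rec a).
move: d1 s1 d0 s0; rewrite -/u -/v.
have := @le_amplification k _ _ p p01w (fun x => monotone_cofactor_le x am).
have /andP[+ _] := amplification_ge0_le1 (cofactor_fun a false) p01w.
have /andP[_ +] := amplification_ge0_le1 (cofactor_fun a true) p01w.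
set a0 := amp (cofactor_fun a false) p; set a0' := amp (cofactor_fun a false) q.
set a1 := amp (cofactor_fun a true) p; set a1' := amp (cofactor_fun a true) q.
move=> a11 a00 a01 d1 s1 d0 s0.
have h1 := d1; have h0 := d0; rewrite subr_ge0 in h1; rewrite subr_ge0 in h0.
have /= := cross_odds_ge0 uv a00 a01 a11 h1 h0.
set e := (X in 0 <= X /\ _) => -[e0 es] /=.
(* Pairs of equal first bits give the induction terms of the two cofactors; pairs of different first
   bits give [e]. *)
have -> : v * (q * a1' + (1 - q) * a0') * (1 - (p * a1 + (1 - p) * a0))
   - u * (p * a1 + (1 - p) * a0) * (1 - (q * a1' + (1 - q) * a0')) =
   p * q * (v * a1' * (1 - a1) - u * a1 * (1 - a1'))
   + (1 - p) * (1 - q) * (v * a0' * (1 - a0) - u * a0 * (1 - a0')) + e.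
  by rewrite /e /u /v; ring.
have q0 : 0 < q by exact: lt_trans pq.
have pq0 : 0 < p * q by exact: mulr_gt0.
have pq1 : 0 < (1 - p) * (1 - q).
  by rewrite mulr_gt0 ?subr_gt0 // (lt_trans pq).
have D1 := mulr_ge0 (ltW pq0) d1; have D0 := mulr_ge0 (ltW pq1) d0.
split=> [|nc np]; first exact: addr_ge0 (addr_ge0 D1 D0) e0.
have [eq_cof|ne_cof] := eqVneq (cofactor_fun a false) (cofactor_fun a true).
  apply: (ltr_wpDr e0); apply: (ltr_wpDr D0).
  apply: mulr_gt0 => //; apply: s1.
    move=> [b E]; apply: nc; exists b; apply: cofactor_eq => c.
    have -> : cofactor_fun a c = cofactor_fun a true by case: c.
    by rewrite E; apply/ffunP => x; rewrite !ffunE.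
  move=> [j E]; apply: np; exists (lift ord0 j); apply: cofactor_eq => c.
  have -> : cofactor_fun a c = cofactor_fun a true by case: c.
  by rewrite E; apply/ffunP => x; rewrite !ffunE liftK.
rewrite ltr_wpDl ?(addr_ge0 D1 D0) //.
apply: es; first by apply: lt_amplification => // x; exact: monotone_cofactor_le.
have [E0|ne0] := eqVneq (cofactor_fun a false) (const_fun k false).
  have [E1|ne1] := eqVneq (cofactor_fun a true) (const_fun k true).
    case: np; exists ord0; apply: cofactor_eq => c.
    by case: c; rewrite ?E0 ?E1; apply/ffunP => x; rewrite !ffunE unlift_none.
  apply/orP; right.
  suff : a1 < amp (const_fun k true) p by rewrite amplification_const.
  by apply: lt_amplification => // x; rewrite [const_fun _ _ _]ffunE implybT.
apply/orP; left.
suff : amp (const_fun k false) p < a0 by rewrite amplification_const.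
by apply: lt_amplification; rewrite 1?eq_sym // => x; rewrite ffunE.
Qed.

End Amplification.

(** * Growth of the amplification function *)

Lemma balanced_not_constant k (a : bool_fun k) : balanced a -> ~ is_constant a.
Proof.
move=> ab [b E]; move: ab; rewrite /balanced E.
have : (0 < #|{: assignment k}|)%N by rewrite card_ffun card_bool expn_gt0.
case: b E => E.
  have -> : [set x | const_fun k true x]%SET = [set: assignment k]%SET.
    by apply/setP => x; rewrite !inE ffunE.
  by rewrite cardsT => + /eqP; rewrite mul2n -addnn -[eqbRHS]addn0 eqn_add2l; case: #|_|.
have -> : [set x | const_fun k false x]%SET = finset.set0.
  by apply/setP => x; rewrite !inE ffunE.
by rewrite cards0 muln0 => + E0; rewrite -E0.
Qed.

Section BalancedAmplification.
Variables (R : realFieldType) (k : nat) (a : bool_fun k).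
Hypotheses (am : monotone_fun a) (ab : balanced a) (ap : ~ is_projection a).

Local Notation amp := (amplification a).

Lemma amplification_half : amp (2^-1 : R) = 2^-1.
Proof.
rewrite /amplification (eq_bigr (fun x => (a x)%:R * 2^-1 ^+ k)) => [|x _]; last first.
  congr (_ * _); rewrite (eq_bigr (fun=> 2^-1)) ?prodr_const ?card_ord // => j _.
  by case: (x j) => //=; lra.
rewrite -mulr_suml -natr_sum sum_bool_fun.
have := congr1 (fun m => m%:R : R) ab; rewrite card_ffun card_bool card_ord.
rewrite natrM natrX => E; apply: (mulfI (_ : 2 != 0 :> R)) => //.
by rewrite mulrA E -exprMn divff // expr1n.
Qed.

(** Against the fixed point [2^-1], the odds difference collapses to [(amp q - q) / 4]. *)
Lemma lt_amplification_half (q : R) : 2^-1 < q -> q < 1 -> q < amp q.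
Proof.
move=> hq q1; have h0 : (0 : R) < 2^-1 by lra.
have [_ /(_ (balanced_not_constant ab) ap)] := amplification_odds am h0 hq q1.
by rewrite amplification_half; nra.
Qed.

Lemma gt_amplification_half (q : R) : 0 < q -> q < 2^-1 -> amp q < q.
Proof.
move=> q0 hq; have h1 : (2^-1 : R) < 1 by lra.
have [_ /(_ (balanced_not_constant ab) ap)] := amplification_odds am q0 hq h1.
by rewrite amplification_half; nra.
Qed.

Lemma amplification_gt0_lt1 (q : R) : 0 < q < 1 -> 0 < amp q < 1.
Proof.
move=> q01; apply/andP; split.
  suff : amplification (const_fun k false) q < amp q by rewrite amplification_const.
  apply: lt_amplification => // [x|]; first by rewrite ffunE.
  by apply/eqP => E; apply: (balanced_not_constant ab); exists false.
suff : amp q < amplification (const_fun k true) q by rewrite amplification_const.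
apply: lt_amplification => // [x|]; first by rewrite [const_fun _ _ _]ffunE implybT.
by apply/eqP => E; apply: (balanced_not_constant ab); exists true.
Qed.

End BalancedAmplification.

(** * Convergence of iterated and contracting sequences *)

Section Limits.
Variable R : realType.

Lemma cvg_amplification k (a : bool_fun k) (u : R^nat) (l : R) :
  u @ \oo --> l -> amplification a \o u @ \oo --> amplification a l.
Proof.
move=> ul; elim: k a => [|k IH] a.
  rewrite (bool_fun0 a).
  under [X in X @ _ --> _]eq_fun do rewrite /= amplification_const.
  by rewrite amplification_const; exact: cvg_cst.
rewrite amplification_rec.
under [X in X @ _ --> _]eq_fun do rewrite /= amplification_rec.
apply: cvgD; apply: cvgM => //; try exact: IH.
by apply: cvgB => //; exact: cvg_cst.
Qed.

(** The sequence increases and is bounded, so its limit is a fixed point of [F] in [(b, 1]], hence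
    1. [F] is abstract because the light points use a conjugate of the amplification. *)
Lemma cvg_iterates_to1 (F : R -> R) (b : R) (u : R^nat) :
  (forall l, u @ \oo --> l -> F \o u @ \oo --> F l) ->
  (forall x, b < x -> x < 1 -> x < F x < 1) ->
  b < u 0%N -> u 0%N < 1 -> (forall i, u i.+1 = F (u i)) ->
  u @ \oo --> (1 : R).
Proof.
move=> Fc FI bu u1 uS.
have uI i : b < u i < 1.
  elim: i => [|i /andP[h1 h2]]; first by rewrite bu.
  by rewrite uS; have /andP[h3 ->] := FI _ h1 h2; rewrite (lt_trans h1).
have ndu : nondecreasing_seq u.
  apply/nondecreasing_seqP => i; have /andP[h1 h2] := uI i.
  by rewrite uS; have /andP[/ltW] := FI _ h1 h2.
have cu : cvgn u.
  apply: nondecreasing_is_cvgn => //; exists 1 => _ [i _ <-].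
  by have /andP[_ /ltW] := uI i.
have ul : u @ \oo --> limn u by [].
have lb : b < limn u by apply: lt_le_trans bu _; exact: nondecreasing_cvgn_le.
have l1 : limn u <= 1.
  by apply: limr_le => //; apply: nearW => i; have /andP[_ /ltW] := uI i.
have FE : F (limn u) = limn u.
  have h := Fc _ ul; apply: (cvg_unique _ h) => //.
  have -> : F \o u = (fun i => u (i + 1)%N).
    by apply/funext => i; rewrite addn1 uS.
  by rewrite /= (cvg_shiftn 1 u).
suff <- : limn u = 1 by [].
apply/eqP; rewrite eq_le l1 leNgt; apply/negP => lt1.
by have := FI _ lb lt1; rewrite FE ltxx.
Qed.

Lemma cvg_contraction0 (d e : R^nat) (c : R) : 0 <= c < 1 ->
  (forall i, 0 <= d i) -> (forall i, d i.+1 <= c * d i + e i) ->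
  e @ \oo --> (0 : R) -> d @ \oo --> (0 : R).
Proof.
move=> /andP[c0 c1] d0 dS e0.
apply/cvgrPdist_le => eps eps0.
(* The map sending [x] to [c * x + eps / 2 * (1 - c)] fixes [eps / 2], so accumulated errors stay
   within [eps / 2]. *)
have ec : 0 < eps / 2 * (1 - c) by rewrite mulr_gt0 ?divr_gt0 ?subr_gt0.
have /cvgrPdist_le /(_ _ ec)[N _ Ne] := e0.
have dN j : d (N + j)%N <= c ^+ j * d N + eps / 2.
  elim: j => [|j IH]; first by rewrite addn0 expr0 mul1r lerDl divr_ge0 // ltW.
  rewrite addnS; apply: le_trans (dS _) _.
  have := Ne (N + j)%N (leq_addr _ _); rewrite /= sub0r normrN => h.
  have := le_trans (ler_norm _) h => he.
  have := ler_wpM2l c0 IH; rewrite exprS => hc.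
  by move: hc he; lra.
have cj : (fun j => c ^+ j * d N) @ \oo --> (0 : R).
  rewrite -(mul0r (d N)); apply: cvgM; last exact: cvg_cst.
  by apply: cvg_expr; rewrite ger0_norm.
have e2 : 0 < eps / 2 by rewrite divr_gt0.
have /cvgrPdist_le /(_ _ e2)[M _ Me] := cj.
exists (N + M)%N => // i /= hi; rewrite sub0r normrN ger0_norm //.
have := dN (i - N)%N; rewrite subnKC ?(leq_trans (leq_addr _ _) hi) // => /le_trans; apply.
have /= := Me (i - N)%N; rewrite leq_subRL ?(leq_trans (leq_addr _ _) hi) // => /(_ hi).
rewrite sub0r normrN => h; have := le_trans (ler_norm _) h; lra.
Qed.

End Limits.

(** * Fourier coefficients of the connective *)

Section Characters.
Variables (R : realFieldType) (I : finType).
Implicit Types (U M : {set I}) (x y : {ffun I -> bool}).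

(** Walsh character over any index type: it serves both for inputs of the connective and for sets of
    assignments, where [x] is a truth table. *)
Definition character U x : R := \prod_(j in U) (-1) ^+ x j.

Lemma character0 x : character finset.set0 x = 1.
Proof. by rewrite /character big_set0. Qed.

Lemma norm_character U x : `|character U x| = 1.
Proof.
rewrite /character normr_prod big1 // => j _.
by case: (x j); rewrite ?expr1 ?normrN normr1.
Qed.

Lemma sum_character M x y :
  \sum_(U : {set I} | U \subset M) character U x * character U y =
  if [forall j in M, x j == y j] then 2 ^+ #|M| else 0.
Proof.
(* The value 0 outside [M] kills the subsets not contained in [M] when the product of the [F j + 1]
   is expanded. *)
pose F j : R := if j \in M then (-1) ^+ x j * (-1) ^+ y j else 0.
transitivity (\prod_j (F j + 1)).
  rewrite bigA_distr [RHS](bigID (fun U : {set I} => U \subset M)) /=.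
  rewrite [X in _ + X]big1 ?addr0.
    apply: eq_bigr => U UM; rewrite /character -big_split [LHS]big_mkcond /=.
    apply: eq_bigr => j _; case: ifP => // jU.
    by rewrite /F (fintype.subsetP UM).
  move=> U /subsetPn[j jU jM]; rewrite (bigD1 j) //= jU /F (negbTE jM).
  by rewrite mul0r.
case: ifPn => [/forallP E|/forallPn[j]].
  rewrite -prodr_const [RHS]big_mkcond; apply: eq_bigr => j _; rewrite /F.
  case: ifP => jM; last by rewrite add0r.
  have := E j; rewrite jM => /eqP ->.
  by rewrite -expr2 sqrr_sign.
rewrite negb_imply => /andP[jM xy]; rewrite (bigD1 j) //= /F jM.
by move: xy; case: (x j); case: (y j); rewrite //= ?expr0 ?expr1 ?mulr1 ?mul1r addNr mul0r.
Qed.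

End Characters.

Section FourierCoefficients.
Variables (R : realFieldType) (k : nat) (a : bool_fun k).
Implicit Types (U : {set 'I_k}) (x : assignment k).

Local Notation chi := (character R).

(** The transform is that of the sign [(-1) ^+ a x], so that balance means a zero coefficient at the
    empty set and the squares sum to 1. *)
Definition fourier_coef U : R :=
  (2 ^+ k)^-1 * \sum_(x : assignment k) (-1) ^+ a x * chi U x.

Local Notation c := fourier_coef.

Lemma fourier_inversion x : (-1) ^+ a x = \sum_U c U * chi U x.
Proof.
transitivity ((2 ^+ k)^-1 *
    \sum_(y : assignment k) (-1) ^+ a y * \sum_U chi U y * chi U x); last first.
  rewrite mulr_sumr; under eq_bigr do rewrite mulr_sumr mulr_sumr.
  rewrite exchange_big; apply: eq_bigr => U _ /=.
  by rewrite /c mulr_sumr mulr_suml; apply: eq_bigr => y _; rewrite !mulrA.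
have E y : \sum_U chi U y * chi U x = if y == x then 2 ^+ k else 0.
  have := sum_character R [set: 'I_k]%SET y x.
  rewrite (eq_bigl predT) => [->|U]; last by rewrite finset.subsetT.
  rewrite cardsT card_ord; congr (if _ then _ else _).
  apply/forallP/eqP => [H|-> j]; last by rewrite eqxx implybT.
  by apply/ffunP => j; have := H j; rewrite finset.in_setT => /eqP.
rewrite (bigD1 x) //= E eqxx big1 ?addr0 => [|y yx]; last first.
  by rewrite E (negbTE yx) mulr0.
by rewrite mulrCA mulVf ?mulr1 // expf_neq0.
Qed.

Lemma parseval : \sum_U c U ^+ 2 = 1.
Proof.
under eq_bigr do rewrite expr2 {2}/c mulrCA mulr_sumr.
rewrite -mulr_sumr exchange_big /=.
rewrite (eq_bigr (fun=> 1)) => [|x _]; last first.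
  under eq_bigr do rewrite mulrCA.
  by rewrite -mulr_sumr -fourier_inversion -expr2 sqrr_sign.
rewrite big_const iter_addr addr0 card_ffun card_bool card_ord.
by rewrite -[1 *+ _]/(_%:R) natrX mulVf // expf_neq0.
Qed.

Hypotheses (am : monotone_fun a) (ab : balanced a) (ap : ~ is_projection a).

Lemma fourier_coef0 : c finset.set0 = 0.
Proof.
rewrite /c; under eq_bigr do rewrite character0 mulr1.
have -> : \sum_x (-1) ^+ a x = \sum_(x : assignment k) (1 - 2 * (a x)%:R) :> R.
  by apply: eq_bigr => x _; case: (a x) => /=; rewrite ?expr1 ?expr0; lra.
rewrite sumrB -mulr_sumr -natr_sum.
by rewrite sum_bool_fun -natrM ab sumr_const subrr mulr0.
Qed.

Definition indicator_assignment (S : {set 'I_k}) : assignment k := [ffun j => j \in S].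

Lemma character_indicator U (S : {set 'I_k}) :
  chi U (indicator_assignment S) = (-1) ^+ #|U :&: S|%SET.
Proof.
rewrite -prodr_const /character (eq_bigr (fun j => if j \in S then -1 else 1)).
  by rewrite -big_mkcondr; apply: eq_bigl => j; rewrite finset.in_setI.
by move=> j _; rewrite ffunE; case: (j \in S); rewrite ?expr1.
Qed.

Lemma signr_bool_inj (b b' : bool) : (-1) ^+ b = (-1) ^+ b' :> R -> b = b'.
Proof. by case: b; case: b' => //; rewrite ?expr1 ?expr0; lra. Qed.

(** Otherwise Parseval leaves a single term, [(-1) ^+ a x = c U * chi U x], with [U] nonempty by
    balance. Monotonicity from the empty set to a singleton gives [c U = 1]; two elements of [U]
    would make the parity drop back to 0 on the pair. So [a] is a projection. *)
Lemma norm_fourier_coef_lt1 U : `|c U| < 1.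
Proof.
have c2 V : 0 <= c V ^+ 2 by exact: sqr_ge0.
have rest0 : 0 <= \sum_(V | V != U) c V ^+ 2 by exact: sumr_ge0.
have := parseval; rewrite (bigD1 U) //= => P.
rewrite ltNge; apply/negP => cU.
have cU2 : 1 <= c U ^+ 2 by rewrite -real_normK ?num_real // exprn_ege1.
have /eqP : \sum_(V | V != U) c V ^+ 2 = 0 by lra.
rewrite psumr_eq0 // => /allP others.
have other V : V != U -> c V = 0.
  by move=> VU; have := others V (mem_index_enum _); rewrite VU sqrf_eq0 => /eqP.
have aE x : (-1) ^+ a x = c U * chi U x.
  rewrite fourier_inversion (bigD1 U) //= big1 ?addr0 // => V VU.
  by rewrite other ?mul0r.
have [U0|[j jU]] := set_0Vmem U.
  by move: cU2; rewrite U0 fourier_coef0 expr0n /=; lra.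
have a0 : (-1) ^+ a (indicator_assignment finset.set0) = c U.
  by rewrite aE character_indicator finset.setI0 cards0 mulr1.
have aj : (-1) ^+ a (indicator_assignment [set j]%SET) = - c U.
  rewrite aE character_indicator; have -> : (U :&: [set j])%SET = [set j]%SET.
    by apply/finset.setIidPr; rewrite finset.sub1set.
  by rewrite cards1 mulrN1.
have le0j : a (indicator_assignment finset.set0) ==> a (indicator_assignment [set j]%SET).
  by apply: am => i; rewrite !ffunE finset.in_set0.
have [a0F ajT] : a (indicator_assignment finset.set0) = false
    /\ a (indicator_assignment [set j]%SET) = true.
  move: le0j a0 aj; case: (a _); case: (a _) => //= _; rewrite ?expr0 ?expr1; lra.
have cU1 : c U = 1 by rewrite -a0 a0F.
have Uj : U = [set j]%SET.
  apply/eqP; rewrite finset.eqEsubset finset.sub1set jU andbT.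
  apply/fintype.subsetP => i iU; rewrite finset.in_set1; apply/negPn/negP => ij.
  have : a (indicator_assignment [set i; j]%SET) = false.
    apply: signr_bool_inj; rewrite aE character_indicator cU1 mul1r.
    have -> : (U :&: [set i; j])%SET = [set i; j]%SET.
      by apply/finset.setIidPr; rewrite finset.subUset !finset.sub1set iU.
    by rewrite cards2 ij /= sqrrN expr1n.
  have : a (indicator_assignment [set j]%SET) ==> a (indicator_assignment [set i; j]%SET).
    by apply: am => l; rewrite !ffunE !inE; case: (l == j); rewrite ?orbT ?implybT.
  by rewrite ajT => /= ->.
apply: ap; exists j; apply/ffunP => x; rewrite [RHS]ffunE.
by apply: signr_bool_inj; rewrite aE cU1 mul1r Uj /character big_set1.
Qed.

(** If only singletons had nonzero coefficients, switching on input [j] would change the sign by [2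
    * c [set j]], which must be 0 or have absolute value 2. As the coefficient is below 1 in
    absolute value it is 0, against Parseval. *)
Lemma fourier_coef_high_degree : exists U, (1 < #|U|)%N && (c U != 0).
Proof.
apply/existsP; case: (boolP [exists U, _]) => // /existsPn H.
have low U : c U != 0 -> (#|U| <= 1)%N.
  by move=> cU; have := H U; rewrite cU andbT -leqNgt.
have c1 j : c [set j]%SET = 0.
  have : (-1) ^+ a (indicator_assignment finset.set0) - (-1) ^+ a (indicator_assignment [set j]%SET)
         = 2 * c [set j]%SET.
    rewrite !fourier_inversion -sumrB (bigD1 [set j]%SET) //= big1 => [|V Vj].
      rewrite !character_indicator finset.setI0 finset.setIid cards0 cards1; lra.
    have [->|/low V1] := eqVneq (c V) 0; first by rewrite !mul0r subrr.
    rewrite !character_indicator finset.setI0; have -> : (V :&: [set j])%SET = finset.set0.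
      apply/finset.setP => i; rewrite !inE; apply/negP => /andP[iV /eqP ij].
      move/negP: Vj; apply.
      by rewrite eq_sym finset.eqEcard finset.sub1set -ij iV cards1.
    by rewrite subrr.
  have := norm_fourier_coef_lt1 [set j]%SET; rewrite ltr_norml => /andP[].
  by case: (a _); case: (a _); rewrite ?expr0 ?expr1; lra.
have := parseval; rewrite big1 => [|U _]; first by move/esym/eqP; rewrite oner_eq0.
have [->|/low] := eqVneq (c U) 0; first by rewrite expr0n.
rewrite leq_eqVlt ltnS leqn0 cards_eq0 => /orP[/cards1P[j ->]|/eqP ->].
  by rewrite c1 expr0n.
by rewrite fourier_coef0 expr0n.
Qed.

Lemma fourier_coef_neq0_gt0 U : c U != 0 -> (0 < #|U|)%N.
Proof.
by move=> cU; rewrite card_gt0; apply: contraNneq cU => ->; rewrite fourier_coef0.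
Qed.

(** Termwise comparison with Parseval, strict where [0 < |c U| < 1]. At [m = 2] the sum is exactly
    1, so pairs of points use [sum_sqr_fourier_coef_lt1] instead. *)
Lemma sum_norm_fourier_coef_lt1 m : (2 < m)%N -> \sum_U `|c U| ^+ m < 1.
Proof.
move=> m2; rewrite -[ltRHS]parseval.
have [U /andP[_ cU]] := fourier_coef_high_degree.
have le V : `|c V| ^+ m <= c V ^+ 2.
  rewrite -[leRHS]ger0_norm ?sqr_ge0 // normrX.
  by apply: ler_wiXn2l => //; [rewrite ltW ?norm_fourier_coef_lt1|exact: ltnW].
rewrite (bigD1 U) //= [ltRHS](bigD1 U) //=; apply: ltr_leD; last exact: ler_sum.
rewrite -[ltRHS]ger0_norm ?sqr_ge0 // normrX.
by rewrite ltr_iXn2l ?normr_gt0 ?norm_fourier_coef_lt1.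
Qed.

Lemma sum_sqr_fourier_coef_lt1 (t : R) : 0 <= t < 1 ->
  \sum_U c U ^+ 2 * t ^+ #|U|.-1 < 1.
Proof.
move=> /andP[t0 t1]; rewrite -[ltRHS]parseval.
have [U /andP[U1 cU]] := fourier_coef_high_degree.
rewrite (bigD1 U) //= [ltRHS](bigD1 U) //=; apply: ltr_leD.
  rewrite gtr_pMr; last by rewrite lt_def sqrf_eq0 cU sqr_ge0.
  by rewrite exprn_ilt1 // -lt0n -ltnS (ltn_predK U1).
apply: ler_sum => V _; apply: ler_piMr; first exact: sqr_ge0.
by rewrite exprn_ile1 // ltW.
Qed.

End FourierCoefficients.

(** * One step of the growth process *)

Section Expectation.
Variables (R : realType) (n : nat).
Implicit Types (p : bool_fun n -> R) (T : {set assignment n}).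

Definition expect p (h : bool_fun n -> R) : R := \sum_f p f * h f.

Definition is_distribution p : Prop := (forall f, 0 <= p f) /\ \sum_f p f = 1.

Definition moment p T : R := expect p (character R T).

Definition prob_true p (x : assignment n) : R :=
  expect p (fun f => (f x)%:R).

Lemma moment0 p : is_distribution p -> moment p finset.set0 = 1.
Proof.
move=> [_ p1]; rewrite -[RHS]p1; apply: eq_bigr => f _.
by rewrite character0 mulr1.
Qed.

Lemma norm_moment_le1 p T : is_distribution p -> `|moment p T| <= 1.
Proof.
move=> [p0 p1]; rewrite -[leRHS]p1; apply: le_trans (ler_norm_sum _ _ _) _.
by apply: ler_sum => f _; rewrite normrM norm_character mulr1 ger0_norm.
Qed.

Lemma moment1 p x : is_distribution p ->
  moment p [set x]%SET = 1 - 2 * prob_true p x.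
Proof.
move=> [_ p1]; rewrite -[X in _ = X - _]p1 mulr_sumr -sumrB; apply: eq_bigr => f _.
rewrite /character big_set1; case: (f x); rewrite /= ?expr1 ?expr0 ?mulr1 ?mulr0; lra.
Qed.

Variables (k : nat) (a : bool_fun k).

Local Notation step := (growth_step a).

Lemma expect_growth_step p h :
  expect (step p) h =
  \sum_(g : {ffun 'I_k -> bool_fun n}) (\prod_(j < k) p (g j)) * h (compose a g).
Proof.
rewrite [RHS](partition_big (compose a) predT) //=; apply: eq_bigr => f _.
by rewrite /growth_step mulr_suml; apply: eq_bigr => g /eqP ->.
Qed.

(** This is independence of the components of [g] under the product law. *)
Lemma expect_prod p (h : 'I_k -> bool_fun n -> R) :
  \sum_(g : {ffun 'I_k -> bool_fun n}) (\prod_(j < k) p (g j)) * \prod_(j < k) h j (g j)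
  = \prod_(j < k) expect p (h j).
Proof.
rewrite (bigA_distr_bigA (fun j f => p f * h j f)).
by apply: eq_bigr => g _; rewrite big_split.
Qed.

Lemma is_distribution_growth_step p : is_distribution p -> is_distribution (step p).
Proof.
move=> [p0 p1]; split=> [f|].
  by apply: sumr_ge0 => g _; apply: prodr_ge0.
transitivity (expect (step p) (fun=> 1)).
  by apply: eq_bigr => f _; rewrite mulr1.
rewrite expect_growth_step.
transitivity (\prod_(j < k) expect p (fun=> 1)).
  rewrite -expect_prod; apply: eq_bigr => g _; congr (_ * _).
  by rewrite big1.
rewrite big1 // => j _; rewrite -[RHS]p1; apply: eq_bigr => f _; exact: mulr1.
Qed.

Lemma prob_true_growth_step p x : is_distribution p ->
  prob_true (step p) x = amplification a (prob_true p x).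
Proof.
move=> [_ p1]; rewrite /prob_true expect_growth_step /amplification.
have bw b : bernoulli_weight (prob_true p x) b = expect p (fun f => (f x == b)%:R).
  case: b => /=; first by apply: eq_bigr => f _; rewrite eqb_id.
  rewrite -[X in X - _]p1 -sumrB; apply: eq_bigr => f _.
  by rewrite eqbF_neg; case: (f x); rewrite /= ?mulr1 ?mulr0 ?subrr ?subr0.
under [RHS]eq_bigr do under eq_bigr do rewrite bw.
under [RHS]eq_bigr do rewrite -expect_prod mulr_sumr.
rewrite exchange_big; apply: eq_bigr => g _ /=.
(* For fixed [g], only the assignment formed by the bits [g j x] has a nonzero product of
   indicators. *)
rewrite (bigD1 [ffun j => g j x]) //= [X in _ + X]big1 => [|y yg].
  rewrite addr0 [RHS]mulrC -mulrA; congr (_ * _).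
  rewrite ffunE big1 ?mul1r // => j _.
  by rewrite ffunE eqxx.
have [j] := ffun_neq yg; rewrite ffunE eq_sym => gj.
by rewrite [X in _ * (_ * X)](bigD1 j) //= (negbTE gj) mul0r !mulr0.
Qed.

(* Expanding [\prod_(x in T) (-1) ^+ alpha (g x)] over all x in T selects one
   Fourier term phi x of alpha per point; these are the points at which the
   selected term contains the j-th input. *)
Definition using_input T (phi : {ffun assignment n -> {set 'I_k}}) (j : 'I_k) :
  {set assignment n} := [set x in T | j \in phi x]%SET.

(** The product over points of the selected terms is regrouped by inputs, so that independence can
    be applied. Requiring [phi] to be empty outside [T] makes each selection occur once. *)
Lemma character_compose T (g : {ffun 'I_k -> bool_fun n}) :
  character R T (compose a g) =
  \sum_(phi in pffun_on finset.set0 (mem T) predT)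
    (\prod_(x in T) fourier_coef R a (phi x)) *
    \prod_(j < k) character R (using_input T phi j) (g j).
Proof.
rewrite /character.
under eq_bigr do rewrite ffunE fourier_inversion.
rewrite (big_distr_big finset.set0) /=; apply: eq_bigr => phi _.
rewrite big_split /=; congr (_ * _).
under eq_bigr do rewrite /character.
rewrite (exchange_big_dep predT) //=; apply: eq_bigr => j _.
rewrite big_mkcond [RHS]big_mkcond; apply: eq_bigr => x _ /=.
by rewrite inE ffunE.
Qed.

(* Then all points of T select the same Fourier term. *)
Definition aligned T (phi : {ffun assignment n -> {set 'I_k}}) : bool :=
  [forall j, (using_input T phi j == finset.set0) || (using_input T phi j == T)].

Definition mixed_moment p T : R :=
  \sum_(phi in pffun_on finset.set0 (mem T) predT | ~~ aligned T phi)
    (\prod_(x in T) fourier_coef R a (phi x)) *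
    \prod_(j < k) moment p (using_input T phi j).

(** An aligned [phi] is constant on [T], say [U]; then the inputs in [U] each contribute the moment
    of [T] and the others that of the empty set, which is 1. *)
Lemma moment_growth_step p T : is_distribution p -> T != finset.set0 ->
  moment (step p) T =
  \sum_U fourier_coef R a U ^+ #|T| * moment p T ^+ #|U| + mixed_moment p T.
Proof.
move=> pd /set0Pn[x0 x0T]; rewrite /moment expect_growth_step.
transitivity (\sum_(phi in pffun_on finset.set0 (mem T) predT)
    (\prod_(x in T) fourier_coef R a (phi x)) *
    \prod_(j < k) moment p (using_input T phi j)).
  under eq_bigr do rewrite character_compose mulr_sumr.
  rewrite exchange_big; apply: eq_bigr => phi _ /=.
  under eq_bigr do rewrite mulrCA.
  by rewrite -mulr_sumr -(expect_prod p (fun j => character R (using_input T phi j))).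
rewrite (bigID (aligned T)) /=; congr (_ + _).
pose cst (U : {set 'I_k}) : {ffun assignment n -> {set 'I_k}} :=
  [ffun x => if x \in T then U else finset.set0].
have ui U j : using_input T (cst U) j = if j \in U then T else finset.set0.
  apply/finset.setP => x; rewrite !inE ffunE.
  by case: ifP => xT; case: ifP => jU; rewrite ?inE ?xT.
(* Evaluation at the chosen point [x0] of [T] recovers the common value. *)
rewrite (reindex_onto cst (fun phi => phi x0)) /=; last first.
  move=> phi /andP[/pffun_onP[/fintype.subsetP supp _] /forallP al].
  apply/ffunP => x; rewrite ffunE; case: ifPn => xT; last first.
    apply/esym/eqP; apply: contraNT xT => xs; exact: supp.
  apply/finset.setP => j; case/orP: (al j) => /eqP /finset.setP E.
    by have := E x; have := E x0; rewrite !inE x0T xT /= => -> ->.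
  by have := E x; have := E x0; rewrite !inE x0T xT /= => -> ->.
apply: eq_big => [U|U _].
  rewrite ffunE x0T eqxx andbT; apply/andP; split.
    apply/pffun_onP; split=> //; apply/fintype.subsetP => x.
    by rewrite unfold_in ffunE /=; case: ifP => //; rewrite eqxx.
  by apply/forallP => j; rewrite ui; case: ifP; rewrite eqxx ?orbT.
congr (_ * _).
  rewrite -prodr_const; apply: eq_bigr => x xT; by rewrite ffunE xT.
rewrite -prodr_const [RHS]big_mkcond; apply: eq_bigr => j _.
by rewrite ui; case: ifP => // _; rewrite moment0.
Qed.

Lemma not_aligned T phi : ~~ aligned T phi -> exists j,
  using_input T phi j != finset.set0 /\ using_input T phi j \proper T.
Proof.
move=> /forallPn[j]; rewrite negb_or => /andP[j0 jT]; exists j; split=> //.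
by rewrite finset.properEneq jT; apply/fintype.subsetP => x; rewrite inE => /andP[].
Qed.

End Expectation.

(** * The process started from projections and constants *)

Section InitialDistribution.
Variables (R : realType) (n : nat).

Local Notation mu := (uniform_on R (initial_support n)).

Lemma proj_fun_neq_const (i : 'I_n) b : proj_fun i <> const_fun n b.
Proof.
move/ffunP => E; have := E [ffun=> ~~ b].
by rewrite !ffunE; case: b {E}.
Qed.

Lemma proj_fun_inj : injective (@proj_fun n).
Proof.
move=> i j /ffunP /(_ [ffun l => l == i]); rewrite !ffunE eqxx.
by move/esym/eqP.
Qed.

Lemma sum_initial_support (V : nmodType) (h : bool_fun n -> V) :
  \sum_(f in initial_support n) h f =
  \sum_(i < n) h (proj_fun i) + (h (const_fun n false) + h (const_fun n true)).
Proof.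
pose A : {set bool_fun n} := [set proj_fun i | i : 'I_n]%SET.
pose B : {set bool_fun n} := [set const_fun n false; const_fun n true]%SET.
transitivity (\sum_(f in [predU A & B]) h f).
  by apply: eq_bigl => f; rewrite finset.in_setU.
rewrite bigU; last first.
  rewrite -setI_eq0; apply/eqP/finset.setP => f; rewrite !inE; apply/negP.
  move=> /andP[/imsetP[i _ ->]] /orP[] /eqP; exact: proj_fun_neq_const.
congr (_ + _).
  by rewrite big_imset => [|i j _ _ /proj_fun_inj //]; apply: eq_bigl.
rewrite big_setU1 ?big_set1 // finset.in_set1; apply/eqP => /ffunP.
by move/(_ [ffun=> true]); rewrite !ffunE.
Qed.

Lemma card_initial_support : #|initial_support n| = n.+2.
Proof.
rewrite -sum1_card sum_initial_support sum1_card card_ord; exact: addn2.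
Qed.

Lemma expect_initial h : expect mu h =
  n.+2%:R^-1 *
  (\sum_(i < n) h (proj_fun i) + (h (const_fun n false) + h (const_fun n true))).
Proof.
rewrite -sum_initial_support mulr_sumr [RHS]big_mkcond; apply: eq_bigr => f _.
by rewrite /uniform_on card_initial_support; case: ifP => // _; rewrite mul0r.
Qed.

Lemma is_distribution_initial : is_distribution mu.
Proof.
split=> [f|]; first by rewrite /uniform_on; case: ifP => // _; rewrite invr_ge0.
transitivity (expect mu (fun=> 1)).
  by apply: eq_bigr => f _; rewrite mulr1.
rewrite expect_initial sumr_const card_ord -[1 + 1]/(2%:R) -natrD addn2.
by rewrite mulVf // pnatr_eq0.
Qed.

(** The functions true at [x] are [weight x] projections and the constant 1. *)
Lemma prob_true_initial x :
  prob_true mu x = (weight x).+1%:R / n.+2%:R.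
Proof.
rewrite /prob_true expect_initial mulrC !ffunE add0r; congr (_ / _).
under eq_bigr do rewrite ffunE.
rewrite -natr_sum -natr1 /weight -sum1dep_card [in RHS]big_mkcond.
by congr (_%:R + _); apply: eq_bigr => i _; case: (x i).
Qed.

(** Some projection separates [x] and [y] and contributes -1, while the constants contribute 2. The
    sum is thus [s + 1] with [|s| <= n], below [n + 2] in absolute value. *)
Lemma norm_moment2_initial_lt1 (x y : assignment n) : x != y ->
  `|moment mu [set x; y]%SET| < 1.
Proof.
move=> xy; rewrite /moment expect_initial.
have cE f : character R [set x; y]%SET f = (-1) ^+ f x * (-1) ^+ f y.
  by rewrite /character big_setU1 ?finset.in_set1 //= big_set1.
have [i xyi] := ffun_neq xy.
rewrite (bigD1 i) //= !cE !ffunE -!expr2 !sqrr_sign.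
have -> : (-1) ^+ x i * (-1) ^+ y i = -1 :> R.
  by move: xyi; case: (x i); case: (y i); rewrite //= ?expr1 ?expr0 ?mulr1 ?mul1r.
set s := \sum_(_ < n | _) _.
have sn : `|s| <= n%:R.
  apply: le_trans (ler_norm_sum _ _ _) _.
  rewrite -[n in leRHS]card_ord -sum1_card natr_sum [leRHS](bigD1 i) //=.
  rewrite ler_wpDl //; apply: ler_sum => j _.
  by rewrite norm_character.
have n0 : (0 : R) < n.+2%:R by rewrite ltr0n.
rewrite normrM normfV (gtr0_norm n0) mulrC ltr_pdivrMr // mul1r.
move: sn; rewrite ler_norml ltr_norml -natr1 -natr1 => /andP[h1 h2].
by apply/andP; split; lra.
Qed.

End InitialDistribution.

(** * Convergence of point probabilities and of middle-layer moments *)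

Section GrowthProcess.
Variables (R : realType) (k n : nat) (a : bool_fun k).
Hypotheses (am : monotone_fun a) (ab : balanced a) (ap : ~ is_projection a).
Hypothesis (n_even : ~~ odd n).

Local Notation mu := (uniform_on R (initial_support n)).
Local Notation G := (growth mu a).
Local Notation c := (fourier_coef R a).

Definition middle_layer : {set assignment n} := [set x | weight x == n./2]%SET.

Local Notation M := middle_layer.

Lemma is_distribution_growth i : is_distribution (G i).
Proof.
elim: i => [|i IH]; first exact: is_distribution_initial.
exact: is_distribution_growth_step.
Qed.

Lemma prob_true_growth i x :
  prob_true (G i.+1) x = amplification a (prob_true (G i) x).
Proof. exact/prob_true_growth_step/is_distribution_growth. Qed.

Lemma n_halves : n.+2 = (n./2.+1 * 2)%N.
Proof. by rewrite -[in LHS](odd_double_half n) (negbTE n_even) muln2. Qed.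

Lemma half_layer : n./2.+1%:R / n.+2%:R = 2^-1 :> R.
Proof. by rewrite n_halves natrM invfM mulrA mulfV ?mul1r // pnatr_eq0. Qed.

(** As [n] is even, the initial probability on the middle layer is exactly [2^-1], a fixed point of
    the amplification. *)
Lemma moment1_middle i x : x \in M -> moment (G i) [set x]%SET = 0.
Proof.
rewrite inE => /eqP xM; rewrite moment1; last exact: is_distribution_growth.
suff -> : prob_true (G i) x = 2^-1 by lra.
elim: i => [|i IH]; first by rewrite prob_true_initial xM half_layer.
by rewrite prob_true_growth IH amplification_half.
Qed.

Lemma cvg_prob_true_heavy x : (n./2 < weight x)%N ->
  (fun i => prob_true (G i) x) @ \oo --> (1 : R).
Proof.
move=> hx; apply: (@cvg_iterates_to1 R (amplification a) 2^-1).
- by move=> l; exact: cvg_amplification.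
- move=> q q0 q1; rewrite lt_amplification_half //=.
  have q01 : 0 < q < 1 by rewrite q1 andbT; apply: lt_trans q0; rewrite invr_gt0.
  by have /andP[] := amplification_gt0_lt1 ab q01.
- by rewrite prob_true_initial -half_layer ltr_pM2r ?invr_gt0 ?ltr0n // ltr_nat ltnS.
(* The constant 0 in the support keeps the start below 1 even at the all-ones assignment. *)
- rewrite prob_true_initial ltr_pdivrMr ?ltr0n // mul1r ltr_nat ltnS ltnS.
  by rewrite /weight -[leqRHS]card_ord max_card.
- by move=> i; exact: prob_true_growth.
Qed.

Lemma cvg_prob_true_light x : (weight x < n./2)%N ->
  (fun i => prob_true (G i) x) @ \oo --> (0 : R).
Proof.
move=> hx.
have h : (fun i => 1 - prob_true (G i) x) @ \oo --> (1 : R).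
  (* Conjugation by [q -> 1 - q] turns convergence to 0 into convergence to 1. *)
  apply: (@cvg_iterates_to1 R (fun q => 1 - amplification a (1 - q)) 2^-1).
  - move=> l ul.
    have ul' : (fun i => 1 - (1 - prob_true (G i) x)) @ \oo --> 1 - l.
      by apply: cvgB => //; exact: cvg_cst.
    by apply: cvgB; [exact: cvg_cst|exact: (cvg_amplification (a := a) ul')].
  - move=> q q0 q1.
    have lt : amplification a (1 - q) < 1 - q by apply: gt_amplification_half => //; lra.
    have q01 : 0 < 1 - q < 1 by apply/andP; split; lra.
    have /andP[gt _] := amplification_gt0_lt1 ab q01.
    by apply/andP; split; lra.
  - suff : prob_true mu x < 2^-1 by rewrite /growth /=; lra.
    by rewrite prob_true_initial -half_layer ltr_pM2r ?invr_gt0 ?ltr0n // ltr_nat ltnS.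
  - suff : 0 < prob_true mu x by rewrite /growth /=; lra.
    by rewrite prob_true_initial divr_gt0 ?ltr0n.
  - by move=> i; rewrite prob_true_growth subKr.
rewrite (_ : (fun i => prob_true (G i) x) = (fun i => 1 - (1 - prob_true (G i) x))).
  by rewrite -[X in _ --> X](subrr 1); apply: cvgB => //; exact: cvg_cst.
by apply/funext => i; rewrite subKr.
Qed.

Lemma norm_moment_growth_step i T : T != finset.set0 ->
  `|moment (G i.+1) T| <=
  \sum_U `|c U| ^+ #|T| * `|moment (G i) T| ^+ #|U| + `|mixed_moment a (G i) T|.
Proof.
move=> T0; rewrite [G i.+1]/(growth_step a (G i)) moment_growth_step //; last first.
  exact: is_distribution_growth.
apply: le_trans (ler_normD _ _) _; rewrite lerD2r.
apply: le_trans (ler_norm_sum _ _ _) _; apply: ler_sum => U _.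
by rewrite normrM !normrX.
Qed.

(** Proper nonempty subsets of [T] are singletons, so the mixed part vanishes. The initial value [t]
    stays an upper bound, which allows one factor of the moment to be taken out and the rest bounded
    by powers of [t]. *)
Lemma moment2_middle_cvg0 (x y : assignment n) : x \in M -> y \in M -> x != y ->
  (fun i => `|moment (G i) [set x; y]%SET|) @ \oo --> (0 : R).
Proof.
move=> xM yM xy; set T := [set x; y]%SET.
have T2 : #|T| = 2%N by rewrite cards2 xy.
have T0 : T != finset.set0 by rewrite -card_gt0 T2.
have mixed0 i : mixed_moment a (G i) T = 0.
  rewrite /mixed_moment big1 // => phi /andP[_ /not_aligned[j [Sj0 SjT]]].
  rewrite [X in _ * X](bigD1 j) //=.
  have /cards1P[z Ez] : #|using_input T phi j| == 1%N.
    by rewrite eqn_leq card_gt0 Sj0 andbT -ltnS -T2 proper_card.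
  have : z \in T by apply: (fintype.subsetP (proper_sub SjT)); rewrite Ez finset.in_set1.
  rewrite Ez !inE => zT; rewrite moment1_middle ?mul0r ?mulr0 //.
  by case/orP: zT => /eqP ->.
set t := `|moment mu T|.
have t01 : 0 <= t < 1 by rewrite normr_ge0 norm_moment2_initial_lt1.
set lam := \sum_U c U ^+ 2 * t ^+ #|U|.-1.
have lam1 : lam < 1 by exact: sum_sqr_fourier_coef_lt1.
have lam0 : 0 <= lam.
  by apply: sumr_ge0 => U _; rewrite mulr_ge0 ?sqr_ge0 // exprn_ge0 ?normr_ge0.
have step i : `|moment (G i) T| <= t ->
    `|moment (G i.+1) T| <= lam * `|moment (G i) T|.
  move=> it; apply: le_trans (norm_moment_growth_step i T0) _.
  rewrite mixed0 normr0 addr0 T2 mulr_suml; apply: ler_sum => U _.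
  rewrite real_normK ?num_real //.
  have [->|cU] := eqVneq (c U) 0; first by rewrite expr0n !mul0r.
  rewrite -mulrA; apply: ler_wpM2l; first exact: sqr_ge0.
  rewrite -[in leLHS](prednK (fourier_coef_neq0_gt0 ab cU)) exprSr.
  apply: ler_wpM2r => //; apply: lerXn2r => //; exact: normr_ge0.
have le_t i : `|moment (G i) T| <= t.
  elim: i => // i IH; apply: le_trans (step _ IH) _; apply: le_trans IH.
  by apply: ler_piMl => //; exact: ltW.
apply: (@cvg_contraction0 R _ (fun=> 0) lam) => //; first by rewrite lam0.
- by move=> i; rewrite addr0 step.
- exact: cvg_cst.
Qed.

(** Strong induction on [#|T|]: smaller moments tend to 0, hence so does the mixed part, which acts
    as the error of a contraction. *)
Lemma moment_middle_cvg0 (T : {set assignment n}) : T \subset M ->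
  T != finset.set0 -> (fun i => `|moment (G i) T|) @ \oo --> (0 : R).
Proof.
have [m] := ubnP #|T|; elim: m T => // m IH T Tm TM T0.
have [T1|T1] := leqP #|T| 1.
  have /cards1P[x Ex] : #|T| == 1%N by rewrite eqn_leq T1 card_gt0.
  have xM : x \in M by move: TM; rewrite Ex finset.sub1set.
  rewrite Ex; under [X in X @ _ --> _]eq_fun do rewrite moment1_middle // normr0.
  exact: cvg_cst.
have [T2|T2] := leqP #|T| 2.
  have /cards2P[x [y [xy ET]]] : #|T| == 2%N by rewrite eqn_leq T2.
  move: TM; rewrite ET finset.subUset !finset.sub1set => /andP[xM yM].
  exact: moment2_middle_cvg0.
set lam := \sum_U `|c U| ^+ #|T|.
have lam1 : lam < 1 by exact: sum_norm_fourier_coef_lt1.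
have lam0 : 0 <= lam by apply: sumr_ge0 => U _; rewrite exprn_ge0.
apply: (@cvg_contraction0 R _ (fun i => `|mixed_moment a (G i) T|) lam) => //.
- by rewrite lam0.
- move=> i; apply: le_trans (norm_moment_growth_step i T0) _.
  rewrite lerD2r mulr_suml; apply: ler_sum => U _.
  have [->|cU] := eqVneq (c U) 0.
    by rewrite normr0 expr0n cards_eq0 (negbTE T0) !mul0r.
  apply: ler_wpM2l; first exact: exprn_ge0.
  rewrite -[leRHS]expr1; apply: ler_wiXn2l => //.
    exact/norm_moment_le1/is_distribution_growth.
  exact: fourier_coef_neq0_gt0 cU.
- suff : (fun i => mixed_moment a (G i) T) @ \oo --> (0 : R).
    by move/cvg_norm; rewrite normr0.
  suff : (fun i => mixed_moment a (G i) T) @ \oo -->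
    \sum_(phi in pffun_on finset.set0 (mem T) predT | ~~ @aligned n k T phi) (0 : R).
    by rewrite big1.
  apply: cvg_big => [|phi /andP[_ /not_aligned[j [Sj0 SjT]]]].
    exact: add_continuous.
  rewrite -(mulr0 (\prod_(x in T) c (phi x))); apply: cvgM; first exact: cvg_cst.
  apply: norm_cvg0.
  have := IH _ (leq_trans (proper_card SjT) Tm)
    (fintype.subset_trans (proper_sub SjT) TM) Sj0.
  (* All other factors have norm at most 1, so the [j]-th moment dominates the product. *)
  apply: squeeze_cvgr (cvg_cst _) => //; apply: nearW => i.
  rewrite normr_ge0 (bigD1 j) //= normrM ler_piMr //.
  rewrite normr_prod; apply: prodr_ile1 => l _.
  by rewrite normr_ge0 norm_moment_le1 //; exact: is_distribution_growth.
Qed.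

(** * From moments to the limiting distribution *)

Definition prob_agree_middle p (f : bool_fun n) : R :=
  expect p (fun g => [forall x in M, g x == f x]%:R).

(** By [sum_character], the indicator of agreement on [M] is a normalized sum of characters. *)
Lemma prob_agree_middleE p (f : bool_fun n) :
  prob_agree_middle p f =
  (2 ^+ #|M|)^-1 * \sum_(T : {set assignment n} | T \subset M)
    character R T f * moment p T.
Proof.
rewrite mulr_sumr; under [RHS]eq_bigr do rewrite mulr_sumr mulr_sumr.
rewrite exchange_big; apply: eq_bigr => g _ /=.
transitivity (p g * ((2 ^+ #|M|)^-1 *
  \sum_(T : {set assignment n} | T \subset M) character R T g * character R T f)).
  rewrite sum_character; case: ifP => _; rewrite ?mulr0 //.
  by rewrite mulVf // expf_neq0.
rewrite !mulr_sumr; apply: eq_bigr => T _.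
by rewrite mulrCA; congr (_ * _); rewrite mulrA mulrC.
Qed.

Lemma cvg_agree_middle (f : bool_fun n) :
  (fun i => prob_agree_middle (G i) f) @ \oo -->
  ((2 ^+ #|M|)^-1 : R).
Proof.
under [X in X @ _ --> _]eq_fun do rewrite prob_agree_middleE.
suff : (fun i => (2 ^+ #|M|)^-1 * \sum_(T : {set assignment n} | T \subset M)
      character R T f * moment (G i) T) @ \oo --> ((2 ^+ #|M|)^-1 * 1 : R).
  by rewrite mulr1.
apply: cvgM; first exact: cvg_cst.
suff : (fun i => \sum_(T : {set assignment n} | T \subset M)
      character R T f * moment (G i) T) @ \oo -->
    \sum_(T : {set assignment n} | T \subset M) ((T == finset.set0)%:R : R).
  rewrite (bigD1 finset.set0) ?finset.sub0set //= eqxx big1 ?addr0 //.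
  by move=> T /andP[_ /negbTE ->].
apply: cvg_big => [|T TM]; first exact: add_continuous.
have [->|T0] := eqVneq T finset.set0.
  under [X in X @ _ --> _]eq_fun do rewrite character0 mul1r
    (moment0 (is_distribution_growth _)).
  exact: cvg_cst.
suff : (fun i => character R T f * moment (G i) T) @ \oo --> character R T f * 0.
  by rewrite mulr0.
apply: cvgM; first exact: cvg_cst.
by apply: norm_cvg0; exact: moment_middle_cvg0.
Qed.

(** A union bound for the probability of not being a slice function. *)
Definition off_middle_error p : R :=
  \sum_(x | x \notin M) expect p (fun g => (g x != (n./2 < weight x)%N)%:R).

Lemma cvg_off_middle_error : (fun i => off_middle_error (G i)) @ \oo --> (0 : R).
Proof.
suff : (fun i => off_middle_error (G i)) @ \oo --> \sum_(x | x \notin M) (0 : R).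
  by rewrite big1.
apply: cvg_big => [|x]; first exact: add_continuous.
rewrite inE neq_ltn => /orP[light|heavy].
  rewrite [X in X @ _ --> _](_ : _ = fun i => prob_true (G i) x).
    exact: cvg_prob_true_light.
  apply/funext => i; apply: eq_bigr => g _.
  by rewrite ltnNge ltnW //=; case: (g x).
rewrite [X in X @ _ --> _](_ : _ = fun i => 1 - prob_true (G i) x).
  suff : (fun i => 1 - prob_true (G i) x) @ \oo --> (1 - 1 : R) by rewrite subrr.
  by apply: cvgB; [exact: cvg_cst|exact: cvg_prob_true_heavy].
apply/funext => i; rewrite heavy.
have [_ G1] := is_distribution_growth i.
rewrite -[X in _ = X - _]G1 -sumrB; apply: eq_bigr => g _.
by case: (g x); rewrite /= ?mulr1 ?mulr0 ?subrr ?subr0.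
Qed.

Lemma slice_functionsP (f : bool_fun n) :
  reflect (forall x, x \notin M -> f x = (n./2 < weight x)%N)
    (f \in slice_functions n./2 n).
Proof.
rewrite inE; apply: (iffP forallP) => H x.
  rewrite inE neq_ltn; have /andP[] := H x.
  by case: (ltngtP (weight x) n./2) => //= _; case: (f x).
have := H x; rewrite inE.
by case: (ltngtP (weight x) n./2) => //= _ -> //.
Qed.

Lemma card_slice_functions : #|slice_functions n./2 n| = (2 ^ #|M|)%N.
Proof.
(* Values are free on the middle layer and forced elsewhere. *)
pose Q (x : assignment n) : pred bool :=
  fun b => (x \in M) || (b == (n./2 < weight x)%N).
rewrite -sum1_card.
transitivity (\sum_(f : bool_fun n | f \in family Q) \prod_(x : assignment n) 1)%N.
  apply: eq_big => [f|f _]; last by rewrite big1.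
  apply/slice_functionsP/familyP => H x.
    by rewrite /Q unfold_in; case: (boolP (x \in M)) => //= /H ->.
  by have := H x; rewrite /Q unfold_in => /orP[->//|/eqP].
rewrite -(bigA_distr_big_dep _ (fun _ _ => 1%N)) -prod_nat_const [RHS]big_mkcond.
apply: eq_bigr => x _; rewrite sum1_card /Q; case: ifP => xM.
  by rewrite -card_bool; exact: eq_card.
rewrite -(card1 (n./2 < weight x)%N); exact: eq_card.
Qed.

Lemma growth_le_off_middle_error i f : f \notin slice_functions n./2 n ->
  G i f <= off_middle_error (G i).
Proof.
have [G0 _] := is_distribution_growth i.
move=> /slice_functionsP fS.
have [x xM fx] : exists2 x, x \notin M & f x != (n./2 < weight x)%N.
  apply: contrapT => H; apply: fS => x xM; apply/eqP/negPn/negP => fx.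
  by apply: H; exists x.
have E0 y : 0 <= expect (G i) (fun g => (g y != (n./2 < weight y)%N)%:R).
  by apply: sumr_ge0 => g _; rewrite mulr_ge0.
rewrite /off_middle_error (bigD1 x) //= ler_wpDr ?sumr_ge0 //.
rewrite /expect (bigD1 f) //= fx mulr1 ler_wpDr // sumr_ge0 // => g _.
by rewrite mulr_ge0.
Qed.

(** The difference is the probability of some [g] other than [f] agreeing with [f] on [M]. Such a
    [g] differs from [f] off the layer, where [f] takes the forced values, and so is counted in the
    error. *)
Lemma agree_middle_sub_growth i f : f \in slice_functions n./2 n ->
  0 <= prob_agree_middle (G i) f - G i f
    <= off_middle_error (G i).
Proof.
have [G0 _] := is_distribution_growth i.
move=> /slice_functionsP fS.
rewrite /prob_agree_middle /expect (bigD1 f) //=.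
have -> : [forall x in M, f x == f x] by apply/forallP => x; rewrite eqxx implybT.
rewrite mulr1 addrAC subrr add0r; apply/andP; split.
  by apply: sumr_ge0 => g _; rewrite mulr_ge0.
rewrite /off_middle_error /expect exchange_big [leRHS](bigD1 f) //=.
apply: ler_wpDl; first by apply: sumr_ge0 => x _; rewrite mulr_ge0.
apply: ler_sum => g gf; rewrite -mulr_sumr; apply: ler_wpM2l => //.
case: (boolP [forall x in M, g x == f x]) => [/forallP agree|_]; last by apply: sumr_ge0.
have [x gx] := ffun_neq gf.
have xM : x \notin M by apply: contra gx => xM; have := agree x; rewrite xM.
by rewrite (bigD1 x) //= -fS // gx ler_wpDr ?sumr_ge0.
Qed.

End GrowthProcess.

Theorem theorem5p16 (R : realType) (k n : nat) (alpha : bool_fun k)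
    (alpha_monotone : monotone_fun alpha)
    (alpha_balanced : balanced alpha)
    (alpha_nonproj : ~ is_projection alpha)
    (n_even : ~~ odd n) :
  limiting_distribution (uniform_on R (initial_support n)) alpha
    (uniform_on R (slice_functions n./2 n)).
Proof.
set mu := uniform_on R (initial_support n).
move=> f; rewrite /uniform_on card_slice_functions natrX.
have e0 : (fun i => off_middle_error (growth mu alpha i)) @ \oo --> (0 : R).
  exact: cvg_off_middle_error.
(* Off the slice functions the probability is squeezed by the error; on them it differs from the
   agreement probability by a null sequence. *)
case: ifPn => fS; last first.
  apply: squeeze_cvgr (cvg_cst _) e0; apply: nearW => i.
  have [-> _] := is_distribution_growth R n alpha i.
  exact: growth_le_off_middle_error.
have d0 : (fun i => prob_agree_middle (growth mu alpha i) f - growth mu alpha i f)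
    @ \oo --> (0 : R).
  by apply: squeeze_cvgr (cvg_cst _) e0; apply: nearW => i; exact: agree_middle_sub_growth.
rewrite [X in X @ _ --> _](_ : _ = fun i =>
    prob_agree_middle (growth mu alpha i) f
    - (prob_agree_middle (growth mu alpha i) f - growth mu alpha i f)).
  suff : (fun i => prob_agree_middle (growth mu alpha i) f
      - (prob_agree_middle (growth mu alpha i) f - growth mu alpha i f)) @ \oo
      --> ((2 ^+ #|middle_layer n|)^-1 - 0 : R).
    by rewrite subr0.
  by apply: cvgB => //; exact: cvg_agree_middle.
by apply/funext => i; rewrite subKr.
Qed.
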